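(* Let $\mathbb{R}_+=(0,+\infty)$ and let $\varphi_1:\mathbb{R}^4_+\rightarrow \mathbb{R}^4_+$ be the map given by $$\varphi_1(x_1,x_2,x_3,x_4)= \left(x_3,\;x_4,\;\frac{x_2+x_3}{x_1},\; \frac{x_1x_4+ x_2+x_3}{x_1x_2}\right).$$ Then $\varphi_1$ is globally 12-periodic, that is, $\varphi_1^{(12)}=\mathrm{Id}$. Moreover: 1. $\varphi_1$ has exactly one fixed point, the point $F=(2,2,2,2)$. 2. Every point in $V\setminus\{F\}$, where $$V=\{(x_1,x_2,x_3,x_4)\in\mathbb{R}_+^4:\; x_4=x_1,\;\; x_1x_2x_3=x_1^2+x_2+x_3\},$$ is periodic with minimal period 4. 3. Every point in $C\setminus\{F\}$, where $$C=\{(x_1,x_2,x_3,x_4)\in\mathbb{R}_+^4:\; x_3=x_2,\;\; x_1x_4=2x_2\},$$ is periodic with minimal period 6. Any other point of $\mathbb{R}_+^4$ (that is, any point not in $V\cup C$) has minimal period 12.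
   Context: $f^{(m)}=f\circ\cdots\circ f$ ($m$ compositions) denotes the $m$-th iterate of $f$. A point $\mathbf{x}$ is periodic for $f$ with minimal period $m\geq 1$ if $f^{(m)}(\mathbf{x})=\mathbf{x}$ and $f^{(k)}(\mathbf{x})\neq\mathbf{x}$ for all $1\le k<m$. *)

(* Defs.v *)
From mathcomp Require Import all_boot all_order all_algebra.
From mathcomp Require Import interval_inference.
From mathcomp Require Import classical_sets reals.

Set Implicit Arguments.
Unset Strict Implicit.
Unset Printing Implicit Defensive.

Import Order.TTheory GRing.Theory Num.Theory.

Local Open Scope ring_scope.
Local Open Scope classical_set_scope.

(* The open orthant of R^4, with points written (x1, x2, x3, x4). *)
Definition posR4 (R : realType) : Type :=
  ({posnum R} * {posnum R} * {posnum R} * {posnum R})%type.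

Definition has_min_period (T : Type) (f : T -> T) (m : nat) (x : T) : Prop :=
  [/\ (1 <= m)%N,
      iter m f x = x
    & forall k : nat, (1 <= k < m)%N -> iter k f x <> x].

Section Phi1.
Variable R : realType.

(* The casts %:pos carry the positivity of each component, so that phi1 maps
   the open orthant to itself by construction. *)
Definition phi1 (x : posR4 R) : posR4 R :=
  let: (x1, x2, x3, x4) := x in
  (x3,
   x4,
   ((x2%:num + x3%:num) / x1%:num)%:pos,
   ((x1%:num * x4%:num + x2%:num + x3%:num) / (x1%:num * x2%:num))%:pos).

Definition F : posR4 R := (2%:pos, 2%:pos, 2%:pos, 2%:pos).

Definition V : set (posR4 R) :=
  [set x | let: (x1, x2, x3, x4) := x in
     x4%:num = x1%:num :> R /\
     x1%:num * x2%:num * x3%:num = x1%:num ^+ 2 + x2%:num + x3%:num :> R].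

Definition C : set (posR4 R) :=
  [set x | let: (x1, x2, x3, x4) := x in
     x3%:num = x2%:num :> R /\ x1%:num * x4%:num = 2 * x2%:num :> R].

End Phi1.

Arguments phi1 : clear implicits.
Arguments V : clear implicits.
Arguments C : clear implicits.

(* Main.v *)
(* Each iterate of phi1 is a Laurent monomial, componentwise, in the coordinates
   a, b, c, d and the two sums b + c and a d + b + c.  The closed form of the
   fourth iterate shows that it fixes exactly V, and the sixth iterate is the
   involution ((b + c) / d, c, b, (b + c) / a), which fixes exactly C; hence
   the twelfth iterate is the identity.  A minimal period dividing m is then
   found by testing only m / p for the primes p dividing m, and the points
   returning after 2 or 3 steps reduce to F. *)
Require Import Defs.
From mathcomp Require Import all_boot all_order all_algebra.
From mathcomp Require Import interval_inference.
From mathcomp Require Import classical_sets reals.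
From mathcomp Require Import ring lra.

Local Open Scope ring_scope.
Local Open Scope classical_set_scope.

Import Order.TTheory GRing.Theory Num.Theory.

Lemma posR4P (R : realType) (a b c d a' b' c' d' : {posnum R}) :
  ((a, b, c, d) : posR4 R) = (a', b', c', d') <->
  [/\ a%:num = a'%:num :> R, b%:num = b'%:num :> R,
      c%:num = c'%:num :> R & d%:num = d'%:num :> R].
Proof.
split=> [[-> -> -> ->] //|[ha hb hc hd]].
by congr (_, _, _, _); apply: val_inj.
Qed.

(** Put s = a d + b + c. Since d + (b + c) / a = s / a, the last numerator c s / (a b) + s / a
    factors as s (b + c) / (a b), so no third sum appears. *)
Lemma phi1_iter2 (R : realType) (a b c d : {posnum R}) :
  iter 2 (phi1 R) (a, b, c, d) =
  (((b%:num + c%:num) / a%:num)%:pos,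
   ((a%:num * d%:num + b%:num + c%:num) / (a%:num * b%:num))%:pos,
   ((a%:num * d%:num + b%:num + c%:num) / (a%:num * c%:num))%:pos,
   ((a%:num * d%:num + b%:num + c%:num) * (b%:num + c%:num)
      / (a%:num * b%:num * c%:num * d%:num))%:pos).
Proof.
by apply/posR4P; split=> //=; field; rewrite ?gt_eqF.
Qed.

Lemma phi1_iter3 (R : realType) (a b c d : {posnum R}) :
  iter 3 (phi1 R) (a, b, c, d) =
  (((a%:num * d%:num + b%:num + c%:num) / (a%:num * c%:num))%:pos,
   ((a%:num * d%:num + b%:num + c%:num) * (b%:num + c%:num)
      / (a%:num * b%:num * c%:num * d%:num))%:pos,
   ((a%:num * d%:num + b%:num + c%:num) / (b%:num * c%:num))%:pos,
   ((a%:num * d%:num + b%:num + c%:num) / (c%:num * d%:num))%:pos).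
Proof.
rewrite iterS phi1_iter2; apply/posR4P.
by split=> //=; field; rewrite ?gt_eqF.
Qed.

Lemma phi1_iter4 (R : realType) (a b c d : {posnum R}) :
  iter 4 (phi1 R) (a, b, c, d) =
  (((a%:num * d%:num + b%:num + c%:num) / (b%:num * c%:num))%:pos,
   ((a%:num * d%:num + b%:num + c%:num) / (c%:num * d%:num))%:pos,
   ((a%:num * d%:num + b%:num + c%:num) / (b%:num * d%:num))%:pos,
   a).
Proof.
rewrite iterS phi1_iter3; apply/posR4P.
by split=> //=; field; rewrite ?gt_eqF.
Qed.

(** With s = a d + b + c, four steps turn b + c into s (b + c) / (b c d) and s into s^2 / (b c d),
    so two further steps cancel s from every component. *)
Lemma phi1_iter6 (R : realType) (a b c d : {posnum R}) :
  iter 6 (phi1 R) (a, b, c, d) =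
  (((b%:num + c%:num) / d%:num)%:pos, c, b,
   ((b%:num + c%:num) / a%:num)%:pos).
Proof.
rewrite (iterD 2 4) phi1_iter4 phi1_iter2; apply/posR4P.
by split=> //=; field; rewrite ?gt_eqF.
Qed.

Lemma phi1_iter12 (R : realType) (x : posR4 R) : iter 12 (phi1 R) x = x.
Proof.
case: x => [[[a b] c] d].
rewrite (iterD 6 6) !phi1_iter6; apply/posR4P.
by split=> //=; field; rewrite ?gt_eqF.
Qed.

Lemma phi1_iter4_fixed (R : realType) (x : posR4 R) :
  iter 4 (phi1 R) x = x <-> V R x.
Proof.
case: x => [[[a b] c] d]; rewrite phi1_iter4 posR4P /=; split.
  case=> h _ _ had; split=> //.
  rewrite -mulrA -{1}h -had divfK ?gt_eqF //; ring.
(* Once the sum equals a b c and d = a, the three quotients collapse to a, b and c. *)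
case=> had h; have hs : a%:num * d%:num + b%:num + c%:num
    = a%:num * b%:num * c%:num :> R by rewrite had h; ring.
by rewrite hs had; split=> //; field; rewrite ?gt_eqF.
Qed.

Lemma phi1_iter6_fixed (R : realType) (x : posR4 R) :
  iter 6 (phi1 R) x = x <-> C R x.
Proof.
case: x => [[[a b] c] d]; rewrite phi1_iter6 posR4P /=; split.
  case=> h hcb _ _; split=> //; move: h.
  by rewrite hcb => <-; field; rewrite ?gt_eqF.
case=> hcb had; rewrite hcb; split=> //.
  have -> : b%:num + b%:num = a%:num * d%:num :> R by rewrite had; ring.
  by field; rewrite ?gt_eqF.
have -> : b%:num + b%:num = a%:num * d%:num :> R by rewrite had; ring.
by field; rewrite ?gt_eqF.
Qed.

Lemma phi1_F (R : realType) : phi1 R (F R) = F R.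
Proof. by apply/posR4P; split=> //=; field. Qed.

Lemma VC_eq_F (R : realType) (x : posR4 R) : V R x -> C R x -> x = F R.
Proof.
case: x => [[[a b] c] d] /= [hda hV] [hcb hC]; apply/posR4P => /=.
rewrite hda hcb in hV hC *.
(* Substituting a^2 = 2 b into [hV] gives a b^2 = 4 b; then a^3 = 2 a b = 8. *)
have hab : a%:num * b%:num = 4 :> R.
  apply: (@mulIf _ (b%:num : R)); first by rewrite gt_eqF.
  by rewrite hV expr2 hC; ring.
have ha : a%:num = 2 :> R.
  have := gt0 a; set t := (a%:num : R) in hab hC * => t0.
  have h3 : t * (t * t) = 8 by rewrite hC mulrCA hab; ring.
  nra.
by move: hab; rewrite ha => hab; split=> //; lra.
Qed.

Lemma phi1_iter3_fixed (R : realType) (x : posR4 R) :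
  iter 3 (phi1 R) x = x -> x = F R.
Proof.
move=> h3.
have hC : C R x by apply/phi1_iter6_fixed; rewrite (iterD 3 3) !h3.
case: x h3 hC => [[[a b] c] d]; rewrite phi1_iter3 => /posR4P /=.
move=> [h1 _ h2 _] [hcb had]; apply/posR4P => /=.
rewrite hcb had in h1 h2 *.
(* On [C] the sum a d + b + c is 4 b, so the third component reads 4 / b = b and the first 4 / a =
   a. *)
have hb : b%:num = 2 :> R.
  have hbb : b%:num * b%:num = 4 :> R by rewrite -{2}h2; field; rewrite ?gt_eqF.
  by apply: (@pexpIrn _ 2); rewrite ?nnegrE // expr2 hbb; ring.
have haa : a%:num * a%:num = 4 :> R.
  by rewrite -{2}h1; field; rewrite ?gt_eqF.
have ha : a%:num = 2 :> R.
  by apply: (@pexpIrn _ 2); rewrite ?nnegrE // expr2 haa; ring.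
by move: had; rewrite ha hb => had; split=> //; lra.
Qed.

Lemma iter_mul_fixed (T : Type) (f : T -> T) (k q : nat) (x : T) :
  iter k f x = x -> iter (q * k) f x = x.
Proof. by move=> fx; elim: q => // q IH; rewrite mulSn iterD IH fx. Qed.

Lemma iter_gcdn_fixed (T : Type) (f : T -> T) (m n : nat) (x : T) :
  (0 < m)%N -> iter m f x = x -> iter n f x = x -> iter (gcdn m n) f x = x.
Proof.
move=> m0 fm fn; case: (egcdnP n m0) => u v e _.
(* Bézout over the naturals: u m = v n + gcd(m, n). *)
by have := iter_mul_fixed _ _ _ u _ fm; rewrite e addnC iterD iter_mul_fixed.
Qed.

(** An earlier return at k would give one at g = gcd(m, k), a proper divisor of m; for a prime p
    dividing m / g, the exponent m / p is a multiple of g and would fix x too. *)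
Lemma has_min_periodP (T : Type) (f : T -> T) (m : nat) (x : T) :
  (0 < m)%N -> iter m f x = x ->
  (forall p, p \in primes m -> iter (m %/ p) f x <> x) ->
  has_min_period f m x.
Proof.
move=> m0 fm hp; split=> // k /andP[k0 km] fk.
have fg := iter_gcdn_fixed _ _ _ _ _ m0 fm fk.
set g := gcdn m k in fg.
have gm : (g %| m)%N by exact: dvdn_gcdl.
have g_le : (g <= k)%N by rewrite dvdn_leq // dvdn_gcdr.
have q1 : (1 < m %/ g)%N.
  by rewrite ltn_divRL // mul1n (leq_ltn_trans g_le).
have pq : (pdiv (m %/ g) %| m %/ g)%N by exact: pdiv_dvd.
have pm : (pdiv (m %/ g) %| m)%N by apply: dvdn_trans pq (dvdn_div gm).
apply: (hp (pdiv (m %/ g))); first by rewrite mem_primes pdiv_prime // m0.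
have /dvdnP[q ->] : (g %| m %/ pdiv (m %/ g))%N.
  by rewrite dvdn_divRL // mulnC -dvdn_divRL.
exact: iter_mul_fixed.
Qed.

Theorem theorem3 (R : realType) :
  [/\ (forall x : posR4 R, iter 12 (phi1 R) x = x),
      (forall x : posR4 R, phi1 R x = x <-> x = F R),
      (forall x : posR4 R, (V R `\ F R) x -> has_min_period (phi1 R) 4 x),
      (forall x : posR4 R, (C R `\ F R) x -> has_min_period (phi1 R) 6 x)
    & (forall x : posR4 R, ~ (V R `|` C R) x -> has_min_period (phi1 R) 12 x)].
Proof.
have iter2_F (x : posR4 R) : iter 2 (phi1 R) x = x -> x = F R.
  move=> h; apply: VC_eq_F.
    by apply/phi1_iter4_fixed; exact: (iter_mul_fixed _ _ 2 2).
  by apply/phi1_iter6_fixed; exact: (iter_mul_fixed _ _ 2 3).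
split=> [x|x|x [Vx xF]|x [Cx xF]|x nVC].
- exact: phi1_iter12.
- split=> [h|->]; last exact: phi1_F.
  by apply: iter2_F; rewrite /= !h.
(* The exponents m / p to exclude are 2 for m = 4, then 3 and 2 for m = 6, then 6 and 4 for m =
   12. *)
- apply: has_min_periodP => //; first exact/phi1_iter4_fixed.
  move=> p; rewrite inE => /eqP -> /iter2_F; exact: xF.
- apply: has_min_periodP => //; first exact/phi1_iter6_fixed.
  move=> p; rewrite !inE => /orP[] /eqP ->.
    by move=> /phi1_iter3_fixed /xF.
  by move=> /iter2_F /xF.
- apply: has_min_periodP => //; first exact: phi1_iter12.
  move=> p; rewrite !inE => /orP[] /eqP -> h; apply: nVC.
    by right; apply/phi1_iter6_fixed.
  by left; apply/phi1_iter4_fixed.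
Qed.
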